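(* Let $\mathbb{V}$ be an $n$-dimensional vector space ($n\ge 1$) over a finite field $\mathbb{F}$ with $q$ elements, with basis $\{\alpha_1,\ldots,\alpha_n\}$, and let $\Gamma(\mathbb{V})$ be its non-zero component graph with respect to this basis. If $q=2$ and $\chi(\Gamma(\mathbb{V}))$ is the chromatic number of $\Gamma(\mathbb{V})$, then $$2^{n-1}\le\chi(\Gamma(\mathbb{V}))\le 2^{n-1}+2^{n-2}-n/2.$$
   Context: Let $\theta$ be the null vector of $\mathbb{V}$. Every $\mathbf{a}\in\mathbb{V}$ is written uniquely as $\mathbf{a}=a_1\alpha_1+\cdots+a_n\alpha_n$. The non-zero component graph $\Gamma(\mathbb{V})$ with respect to the basis $\{\alpha_1,\ldots,\alpha_n\}$ is the simple graph with vertex set $\mathbb{V}\setminus\{\theta\}$ in which two distinct vertices $\mathbf{a},\mathbf{b}$ are adjacent if and only if there is at least one $i$ such that the coefficients of $\alpha_i$ in $\mathbf{a}$ and in $\mathbf{b}$ are both non-zero. The bounds are inequalities of rational numbers. *)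

(* Defs.v *)
From HB Require Import structures.
From mathcomp Require Import all_boot all_order all_algebra all_field.

Set Implicit Arguments.
Unset Strict Implicit.
Unset Printing Implicit Defensive.

Import GRing.Theory.

Local Open Scope ring_scope.

Record sgraph := SGraph {
  vertex :> finType;
  adj : rel vertex;
  adj_sym : symmetric adj;
  adj_irrefl : irreflexive adj }.

Definition colorable (G : sgraph) (k : nat) : bool :=
  [exists c : {ffun G -> 'I_k},
     [forall x, forall y, adj x y ==> (c x != c y)]].

Lemma colorable_card (G : sgraph) : colorable G #|G|.
Proof.
apply/existsP; exists [ffun x => enum_rank x].
apply/forallP => x; apply/forallP => y; apply/implyP => xy.
rewrite !ffunE; apply/eqP => /enum_rank_inj exy.
by move: xy; rewrite exy adj_irrefl.
Qed.

Definition chromatic_number (G : sgraph) : nat :=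
  ex_minn (ex_intro (fun k => colorable G k) #|G| (colorable_card G)).

Section NonZeroComponentGraph.

Variables (F : finFieldType) (V : vectType F) (n : nat) (X : n.-tuple V).

(* [finvect_type V] is [V] itself, equipped with the finite type structure it
   inherits from the finite field [F]. *)
Definition nzvector : finType := {v : finvect_type V | v != 0}.

(* When [X] is a basis of [V], [coord X i v] is the coefficient of [X`_i] in
   [v]. *)
Definition nzc_adj : rel nzvector := fun a b =>
  (a != b) &&
  [exists i : 'I_n,
     (coord X i (val a : V) != 0) && (coord X i (val b : V) != 0)].

Lemma nzc_adj_sym : symmetric nzc_adj.
Proof.
move=> a b; rewrite /nzc_adj eq_sym; congr (_ && _).
by apply: eq_existsb => i; rewrite andbC.
Qed.

Lemma nzc_adj_irrefl : irreflexive nzc_adj.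
Proof. by move=> a; rewrite /nzc_adj eqxx. Qed.

Definition nzc_graph : sgraph := SGraph nzc_adj_sym nzc_adj_irrefl.

End NonZeroComponentGraph.

(* Main.v *)
Require Import Defs.
From mathcomp Require Import all_boot all_order all_algebra all_field.
From mathcomp Require Import lra zify.

(** Over the field with two elements a vector is determined by its support, so
    the graph is the intersection graph of the non-empty subsets of the index
    set, and its chromatic number is exactly 2 ^ (n - 1).
    For the lower bound, the subsets that contain one fixed index meet pairwise,
    and there are 2 ^ (n - 1) of them ([leq_expn_chromatic_nzc]). For the upper
    bound, a subset and its complement are not adjacent, hence may share a
    colour; the complementary pairs number 2 ^ (n - 1), the full set being
    paired with the empty one ([chromatic_nzc_leq_expn]).
    The upper bound of the theorem exceeds this value by 2 ^ (n - 2) - n / 2,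
    which is non-negative because n <= 2 ^ (n - 1). *)

Set Implicit Arguments.
Unset Strict Implicit.
Unset Printing Implicit Defensive.

Import GRing.Theory Num.Theory.

Local Open Scope ring_scope.

Lemma chromatic_number_leq (G : sgraph) (C : finType) (c : G -> C) :
  (forall x y, adj x y -> c x != c y) -> (chromatic_number G <= #|C|)%N.
Proof.
move=> c_proper; rewrite /chromatic_number; case: ex_minnP => k _; apply.
apply/existsP; exists [ffun x => enum_rank (c x)].
apply/forallP => x; apply/forallP => y; apply/implyP => /c_proper.
by rewrite !ffunE (inj_eq enum_rank_inj).
Qed.

Lemma clique_leq_chromatic_number (G : sgraph) (T : finType) (f : T -> G) :
  (forall s t, s != t -> adj (f s) (f t)) -> (#|T| <= chromatic_number G)%N.
Proof.
move=> f_clique; rewrite /chromatic_number.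
case: ex_minnP => k /existsP[c /forallP c_proper] _.
suff /leq_card : injective (c \o f) by rewrite card_ord.
move=> s t /= cst; apply/eqP/contraT => /f_clique st.
by have /forallP/(_ (f t))/implyP/(_ st) := c_proper (f s); rewrite cst eqxx.
Qed.

Lemma card2_field_neq0 (F : finFieldType) (x : F) :
  #|F| = 2%N -> x != 0 -> x = 1.
Proof.
move=> F2 x0; apply/eqP/contraT => x1.
have := max_card (mem [:: 0; 1; x]); rewrite F2.
have /card_uniqP-> // : uniq [:: 0; 1; x].
by rewrite /= !inE negb_or eq_sym oner_eq0 eq_sym x0 eq_sym x1.
Qed.

Lemma card_set_ord m : #|{set 'I_m}| = (2 ^ m)%N.
Proof. by rewrite -cardsT -powersetT card_powerset cardsT card_ord. Qed.

Section BasisSupport.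

Variables (F : finFieldType) (V : vectType F) (m : nat) (X : m.+1.-tuple V).
Hypothesis X_basis : basis_of {:V} X.

Definition vector_through0 (S : {set 'I_m}) : V :=
  \sum_(i < m.+1) (if unlift ord0 i is Some j then (j \in S)%:R else 1) *: X`_i.

Lemma coord_vector_through0 S i :
  coord X i (vector_through0 S) =
  if unlift ord0 i is Some j then (j \in S)%:R else 1.
Proof.
exact: (coord_sum_free (fun i => if unlift ord0 i is Some j then _ else _)
         i (basis_free X_basis)).
Qed.

Lemma vector_through0_neq0 S : vector_through0 S != 0.
Proof.
apply/eqP => /(congr1 (coord X ord0)) /eqP.
by rewrite coord_vector_through0 unlift_none linear0 oner_eq0.
Qed.

Lemma vector_through0_inj : injective vector_through0.
Proof.
move=> S T ST; apply/setP => j.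
have /eqP := congr1 (coord X (lift ord0 j)) ST.
rewrite !coord_vector_through0 liftK.
by case: (j \in S); case: (j \in T); rewrite // ?(eq_sym 0) oner_eq0.
Qed.

(** The vectors with coefficient 1 at [ord0] and coefficients 0 or 1 elsewhere
    form a clique, over any finite field. *)
Lemma leq_expn_chromatic_nzc : (2 ^ m <= chromatic_number (nzc_graph X))%N.
Proof.
rewrite -card_set_ord.
pose f S : nzc_graph X :=
  exist (fun v : finvect_type V => v != 0) _ (vector_through0_neq0 S).
apply: (@clique_leq_chromatic_number _ _ f) => S T ST; apply/andP; split.
  by apply: contra ST => /eqP/(congr1 val)/vector_through0_inj->.
apply/existsP; exists ord0.
by rewrite /= !coord_vector_through0 unlift_none oner_eq0.
Qed.

Hypothesis F2 : #|F| = 2%N.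

Lemma eq_support (u v : V) :
  (forall i, (coord X i u != 0) = (coord X i v != 0)) -> u = v.
Proof.
move=> uv; rewrite [LHS](coord_basis X_basis (memvf u)).
rewrite [RHS](coord_basis X_basis (memvf v)).
apply: eq_bigr => i _; congr (_ *: _); have := uv i.
have [-> | u0] := eqVneq (coord X i u) 0.
  by move/esym/negbFE/eqP->.
by move/esym => v0; rewrite (card2_field_neq0 F2 u0)
    (card2_field_neq0 F2 v0).
Qed.

(** A set of indices and its complement get the same value: the member of the
    pair that avoids [ord0], read as a subset of the remaining indices. *)
Definition complement_pair (v : V) : {set 'I_m} :=
  [set j | (coord X (lift ord0 j) v != 0) (+) (coord X ord0 v != 0)].

(** [complement_pair] is a proper colouring: two distinct vectors with the same
    colour have complementary supports, so no index makes them adjacent. *)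
Lemma chromatic_nzc_leq_expn : (chromatic_number (nzc_graph X) <= 2 ^ m)%N.
Proof.
rewrite -card_set_ord.
pose colour (a : nzc_graph X) := complement_pair (val a : V).
apply: (@chromatic_number_leq _ _ colour) => a b.
case/andP => ab /existsP[i /andP[ai bi]]; apply: contra ab => /eqP/setP cab.
apply/eqP/val_inj/eq_support.
(* The common index [i] excludes complementary supports, so the two supports
   agree at [ord0], and therefore everywhere. *)
have ab0 : (coord X ord0 (val a : V) != 0) = (coord X ord0 (val b : V) != 0).
  have [j ij | i0] := unliftP ord0 i; last by rewrite -i0 ai bi.
  by have := cab j; rewrite !inE -ij ai bi => /addbI.
move=> k; have [j -> | ->] := unliftP ord0 k; last exact: ab0.
by have := cab j; rewrite !inE ab0 => /addIb.
Qed.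

End BasisSupport.

Theorem corollary4p3 (F : finFieldType) (V : vectType F) (n q : nat)
    (alpha : n.-tuple V) :
  (1 <= n)%N -> \dim {:V} = n -> basis_of {:V} alpha ->
  #|F| = q -> q = 2%N ->
  let chi : rat := (chromatic_number (nzc_graph alpha))%:R in
  2 ^ (n%:Z - 1) <= chi /\
  chi <= 2 ^ (n%:Z - 1) + 2 ^ (n%:Z - 2) - n%:R / 2.
Proof.
case: n alpha => // m alpha _ _ alpha_basis Fq q2; rewrite {}q2 in Fq.
have -> : chromatic_number (nzc_graph alpha) = (2 ^ m)%N.
  by apply/eqP; rewrite eqn_leq chromatic_nzc_leq_expn // leq_expn_chromatic_nzc.
have pow1 : (2 : rat) ^ (m.+1%:Z - 1) = 2 ^+ m.
  by have -> : m.+1%:Z - 1 = m%:Z by lia.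
have pow2 : (2 : rat) ^ (m.+1%:Z - 2) = 2 ^+ m / 2.
  have -> : m.+1%:Z - 2 = m%:Z - 1 by lia.
  by rewrite expfzDr.
have m_lt : m.+1%:R <= 2 ^+ m :> rat by rewrite -natrX ler_nat ltn_expl.
by rewrite /= pow1 pow2 natrX; split; lra.
Qed.
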